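(* Let $\mathcal T$ be a triangulation mixed with triangles and twin triangles, and let $\mathcal F(u^-,u^+;\boldsymbol n)$ be a monotone Lipschitz continuous numerical flux function for the scalar conservation law $\partial_t u+\nabla\cdot\boldsymbol F(u)=0$ in two space dimensions. Let $u_0^n$ denote the cell average at time level $n$ on a cell $T_0\in\mathcal T$ with $J$ edges $e_1,\dots,e_J$, and let $u_j^n$ be the cell average on the neighbor of $T_0$ across $e_j$. Suppose that for each cell $T_0\in\mathcal T$ the linear reconstruction satisfies $$\min\{u_0^n,u_j^n\}\le u_j^-\le \max\{u_0^n,u_j^n\},\qquad j=1,2,\dots,J.$$ Then the finite volume scheme $$u_0^{n+1}=u_0^n-\frac{\Delta t_n}{|T_0|}\sum_{j=1}^J\mathcal F(u_j^-,u_j^+;\boldsymbol n_j)\,|e_j|$$ fulfills the local maximum principle $$\min\{u_0^n,u_1^n,\dots,u_J^n\}\le u_0^{n+1}\le\max\{u_0^n,u_1^n,\dots,u_J^n\}$$ under the CFL-like condition $$\Delta t_n\,\sup_{u^-,u^+,\boldsymbol n}\left|\frac{\partial\mathcal F(u^-,u^+;\boldsymbol n)}{\partial u^+}\right|\le\frac1{12}h,$$ where $h$ is the minimum size of the cells of $\mathcal T$ measured by the diameters of their inscribed circles.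
   Context: Mesh. The cells of $\mathcal T$ are (geometric) triangles in $\mathbb R^2$. A cell of type ''triangle'' has $J=3$ edges $e_1,e_2,e_3$, its three sides. A cell of type ''twin triangle'' is a triangle one of whose sides is shared by two neighbors and is divided at its midpoint into two edges of equal length; it is treated as a (degenerate) quadrilateral with $J=4$ edges, where $e_1,e_2$ are the two undivided sides and $e_3,e_4$ are the two halves of the divided side (so $\boldsymbol n_3=\boldsymbol n_4$). Each edge $e_j$ of $T_0$ under consideration is an entire edge shared by $T_0$ and exactly one neighboring cell $T_j$ (interior edges, or edges identified through periodic boundary conditions), and it is counted as an edge, with the same midpoint, for both cells. The statement concerns cells all of whose edges are of this kind. $|T_0|$ is the area of $T_0$, $|e_j|$ the length of $e_j$, $\boldsymbol z_j$ the midpoint of $e_j$, and $\boldsymbol n_j$ the unit normal to $e_j$ outward from $T_0$. $\Delta t_n>0$ is the time step. Reconstruction. On each cell $T_0$ with centroid $\boldsymbol x_0$ and cell average $u_0^n$, a linear reconstruction is a function $\hat u_0(\boldsymbol x)=u_0^n+\boldsymbol L^\top(\boldsymbol x-\boldsymbol x_0)$ with some gradient vector $\boldsymbol L\in\mathbb R^2$ (depending on the cell). The interior trace is $u_j^-=\hat u_0(\boldsymbol z_j)$; the exterior trace $u_j^+$ is the value at $\boldsymbol z_j$ of the linear reconstruction on the neighboring cell $T_j$ (that is, it is the interior trace of $T_j$ at that edge). Numerical flux. $\mathcal F(u^-,u^+;\boldsymbol n)$ is defined for $u^\pm\in\mathbb R$ and unit vectors $\boldsymbol n\in\mathbb R^2$;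 it is consistent, $\mathcal F(u,u;\boldsymbol n)=\boldsymbol F(u)\cdot\boldsymbol n$; conservative, $\mathcal F(u^-,u^+;\boldsymbol n)=-\mathcal F(u^+,u^-;-\boldsymbol n)$; Lipschitz continuous in $(u^-,u^+)$; and monotone, i.e. non-decreasing in $u^-$ and non-increasing in $u^+$. The supremum in the CFL-like condition is over all $u^\pm\in\mathbb R$ and unit vectors $\boldsymbol n$; where $\mathcal F$ is not differentiable, it is understood as the smallest Lipschitz constant of $\mathcal F$ in the variable $u^+$, uniform in $u^-$ and $\boldsymbol n$. *)

(* Defs.v *)
From HB Require Import structures.
From mathcomp Require Import all_boot all_order all_algebra.
From mathcomp Require Import all_classical all_reals all_analysis.

Set Implicit Arguments.
Unset Strict Implicit.
Unset Printing Implicit Defensive.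

Import Order.TTheory GRing.Theory Num.Theory.
Local Open Scope classical_set_scope.
Local Open Scope ring_scope.

(* The library norm on row vectors is the sup norm, hence the explicit
   Euclidean one. *)
Definition dotp (R : realType) (x y : 'rV[R]_2) : R :=
  \sum_(i < 2) x 0 i * y 0 i.

Definition enorm (R : realType) (x : 'rV[R]_2) : R := Num.sqrt (dotp x x).

Definition unit_vector (R : realType) (n : 'rV[R]_2) : Prop := enorm n = 1.

Definition midpoint (R : realType) (a b : 'rV[R]_2) : 'rV[R]_2 :=
  2^-1 *: (a + b).

Definition segment (R : realType) (a b : 'rV[R]_2) : set 'rV[R]_2 :=
  [set x | exists2 t : R, 0 <= t <= 1 & x = (1 - t) *: a + t *: b].

(* A cell is a triangle with a type flag. The vertices are listed in either
   orientation; in a twin triangle they are labelled so that the divided side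
   is the one joining [vtx3] to [vtx1]. *)
Record cell_shape (R : realType) := CellShape {
  vtx1 : 'rV[R]_2;
  vtx2 : 'rV[R]_2;
  vtx3 : 'rV[R]_2;
  twin : bool }.

Section CellShape.
Variable R : realType.
Implicit Types (s : cell_shape R) (n x : 'rV[R]_2).

Definition cell_set s : set 'rV[R]_2 :=
  [set x | exists a b c : R, [/\ 0 <= a, 0 <= b, 0 <= c, a + b + c = 1 &
    x = a *: vtx1 s + b *: vtx2 s + c *: vtx3 s]].

Definition area s : R :=
  let a := vtx2 s - vtx1 s in
  let b := vtx3 s - vtx1 s in
  2^-1 * `|a 0 0 * b 0 1 - a 0 1 * b 0 0|.

Definition centroid s : 'rV[R]_2 := 3^-1 *: (vtx1 s + vtx2 s + vtx3 s).

Definition nedges s : nat := if twin s then 4 else 3.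

(* A twin triangle is a degenerate quadrilateral, whose fourth corner is the
   midpoint of the divided side. *)
Definition corner s (j : 'I_(nedges s)) : 'rV[R]_2 :=
  nth 0 [:: vtx1 s; vtx2 s; vtx3 s; midpoint (vtx3 s) (vtx1 s)] j.

(* The edge j joins corner j to the cyclically next corner; thus the last two
   edges of a twin triangle are the halves of its divided side. *)
Definition edge_src s (j : 'I_(nedges s)) : 'rV[R]_2 := corner j.
Definition edge_tgt s (j : 'I_(nedges s)) : 'rV[R]_2 := corner (ordS j).

Definition edge_length s (j : 'I_(nedges s)) : R :=
  enorm (edge_tgt j - edge_src j).

Definition edge_mid s (j : 'I_(nedges s)) : 'rV[R]_2 :=
  midpoint (edge_src j) (edge_tgt j).

Definition outward_normal s (j : 'I_(nedges s)) n : Prop :=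
  [/\ unit_vector n,
      dotp n (edge_tgt j - edge_src j) = 0 &
      dotp n (centroid s - edge_mid j) < 0].

Definition inscribed_circle s x (r : R) : Prop :=
  let touches a b := exists2 y, segment a b y & enorm (y - x) = r in
  [/\ 0 < r,
      forall y, enorm (y - x) <= r -> cell_set s y,
      touches (vtx1 s) (vtx2 s),
      touches (vtx2 s) (vtx3 s) &
      touches (vtx3 s) (vtx1 s)].

(* A nondegenerate triangle has exactly one inscribed circle, so the default
   value 0 plays no role. *)
Definition incircle_diameter s : R :=
  xget 0 [set d | exists x r, inscribed_circle s x r /\ d = 2 * r].

(* [same_edge j j' p]: the edge j' translated by p is the edge j. *)
Definition same_edge s s' (j : 'I_(nedges s)) (j' : 'I_(nedges s'))
    (p : 'rV[R]_2) : Prop :=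
  (edge_src j = edge_src j' + p /\ edge_tgt j = edge_tgt j' + p) \/
  (edge_src j = edge_tgt j' + p /\ edge_tgt j = edge_src j' + p).

End CellShape.

(* [period] is the group of translations realising the periodic boundary
   conditions; it is [set 0] when there are none, and a cell stands for all
   its translates. Conformity is that of a mesh of polygons in which the twin
   triangles are quadrilaterals: two distinct cells are disjoint, or meet
   exactly in a common corner, or meet exactly in an entire common edge.
   Edges without a neighbour are the boundary edges; the two halves of a
   divided side always have neighbours, and by conformity distinct ones. *)
Record mesh (R : realType) := Mesh {
  cell : finType;
  geom : cell -> cell_shape R;
  period : set 'rV[R]_2;
  mesh_nondegenerate : forall c, 0 < area (geom c);
  mesh_period0 : period 0;
  mesh_periodB : forall p q, period p -> period q -> period (p - q);
  mesh_conforming : forall (c c' : cell) (p : 'rV[R]_2),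
    period p -> c <> c' \/ p <> 0 ->
    let meet := cell_set (geom c) `&` [set x + p | x in cell_set (geom c')] in
    [\/ meet = set0,
        exists (i : 'I_(nedges (geom c))) (i' : 'I_(nedges (geom c'))),
          corner i = corner i' + p /\ meet = [set corner i] |
        exists (j : 'I_(nedges (geom c))) (j' : 'I_(nedges (geom c'))),
          same_edge j j' p /\
          meet = segment (edge_src j) (edge_tgt j)];
  mesh_twin : forall (c : cell) (j : 'I_(nedges (geom c))),
    twin (geom c) -> (2 <= j)%N ->
    exists (c' : cell) (j' : 'I_(nedges (geom c'))) (p : 'rV[R]_2),
      [/\ period p, c <> c' \/ p <> 0 & same_edge j j' p] }.

Section Mesh.
Variables (R : realType) (T : mesh R).

Definition edge := {c : cell T & 'I_(nedges (geom c))}.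

(* e and e' are one and the same edge of the mesh, seen from the two cells that
   share it. *)
Definition shared_edge (e e' : edge) : Prop :=
  exists p : 'rV[R]_2,
    [/\ period T p, tag e <> tag e' \/ p <> 0 &
        same_edge (tagged e) (tagged e') p].

(* The minimum of a finite set, which is nonempty once T has a cell. *)
Definition mesh_size : R :=
  inf [set incircle_diameter (geom c) | c in [set: cell T]].

Definition reconstruction (u : cell T -> R) (L : cell T -> 'rV[R]_2)
    (c : cell T) (x : 'rV[R]_2) : R :=
  u c + dotp (L c) (x - centroid (geom c)).

Definition interior_trace (u : cell T -> R) (L : cell T -> 'rV[R]_2)
    (e : edge) : R :=
  reconstruction u L (tag e) (edge_mid (tagged e)).

(* [nu j] is the outward unit normal of the edge j of c, and [nbr j] is this
   edge as seen from the neighbour across it. The exterior trace at j is thus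
   the interior trace at [nbr j]: the midpoints coincide, up to the translation
   identifying the two edges in the periodic case. *)
Definition fv_update (Fh : R -> R -> 'rV[R]_2 -> R) (dt : R)
    (u : cell T -> R) (L : cell T -> 'rV[R]_2) (c : cell T)
    (nu : 'I_(nedges (geom c)) -> 'rV[R]_2)
    (nbr : 'I_(nedges (geom c)) -> edge) : R :=
  u c - dt / area (geom c) *
    \sum_(j < nedges (geom c))
      Fh (interior_trace u L (existT _ c j)) (interior_trace u L (nbr j)) (nu j)
        * edge_length j.

End Mesh.

Section Flux.
Variable R : realType.
Implicit Types (F : R -> 'rV[R]_2) (Fh : R -> R -> 'rV[R]_2 -> R).

Definition flux_consistent F Fh : Prop :=
  forall u n, unit_vector n -> Fh u u n = dotp (F u) n.

Definition flux_conservative Fh : Prop :=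
  forall um up n, unit_vector n -> Fh um up n = - Fh up um (- n).

Definition flux_lipschitz Fh : Prop :=
  forall n, unit_vector n -> exists K : R, forall um up vm vp,
    `|Fh um up n - Fh vm vp n| <= K * (`|um - vm| + `|up - vp|).

Definition flux_monotone Fh : Prop :=
  forall n, unit_vector n ->
    (forall um vm up, um <= vm -> Fh um up n <= Fh vm up n) /\
    (forall um up vp, up <= vp -> Fh um vp n <= Fh um up n).

(* The supremum of |dFh/du+|, read as the smallest Lipschitz constant in u+
   uniform in u- and n; it is +oo when there is no uniform constant. *)
Definition flux_sup_deriv Fh : \bar R :=
  ereal_inf [set K%:E | K in [set K : R | 0 <= K /\
    forall um up vp n, unit_vector n ->
      `|Fh um up n - Fh um vp n| <= K * `|up - vp|]].

End Flux.

(* Main.v *)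
Require Import Defs.
From HB Require Import structures.
From mathcomp Require Import all_boot all_order all_algebra.
From mathcomp Require Import all_classical all_reals all_analysis.
From mathcomp Require Import ring lra.

Set Implicit Arguments.
Unset Strict Implicit.
Unset Printing Implicit Defensive.

Import Order.TTheory GRing.Theory Num.Theory.
Local Open Scope classical_set_scope.
Local Open Scope ring_scope.

(** Only the upper bound is discussed; the lower one is symmetric.  Let M be the
    largest of the cell averages around T_0.  The reconstruction hypothesis,
    applied to T_0 and to its neighbours, puts all traces u_j^-, u_j^+ below M.
    By monotonicity and the Lipschitz bound K, which conservation transfers
    from the second argument of the flux to the first,
      F(M, M; n_j) - F(u_j^-, u_j^+; n_j) <= K (M - u_j^-)
    ([flux_deficit_max]).  The vectors |e_j| n_j sum to zero around the cell
    and the flux is consistent, so the constant state M contributes nothing to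
    the flux balance ([flux_sum_const]), and
      u_0^{n+1} <= u_0^n + dt K / |T_0| * \sum_j |e_j| (M - u_j^-).

    The geometric fact that closes the argument is that a linear function is
    averaged exactly by the side midpoints of a triangle.  With the weight
    w_j = 1 on an undivided side and 1/2 on each half of a divided side, the
    w_j add up to 3 and \sum_j w_j (z_j - x_0) = 0, hence
      \sum_j w_j (M - u_j^-) = 3 (M - u_0^n)
    with nonnegative terms.  It remains to compare |e_j| with w_j: the disc of
    diameter d inscribed in T_0 fits in the strip between a side and the
    parallel through the opposite vertex, whose width is 2 |T_0| / side, so that
    d |e_j| <= 2 w_j |T_0| ([incircle_diameter_edge_length]).  Under the CFL
    condition dt K <= d / 12 the last term of the bound on u_0^{n+1} is then at
    most (M - u_0^n) / 2, which even leaves a factor 2 to spare. *)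

(** * The Euclidean plane *)

Section Plane.
Variable R : realType.
Implicit Types (x y d n w : 'rV[R]_2).

Definition cross x y : R := x 0 0 * y 0 1 - x 0 1 * y 0 0.

Definition rot x : 'rV[R]_2 := \row_i (if i == 0 then - x 0 1 else x 0 0).

Lemma dotpE x y : dotp x y = x 0 0 * y 0 0 + x 0 1 * y 0 1.
Proof.
rewrite /dotp big_ord_recl big_ord1.
by have -> : lift ord0 ord0 = 1 :> 'I_2 by apply/val_inj.
Qed.

Lemma dotp_suml (I : finType) (f : I -> 'rV[R]_2) y :
  dotp (\sum_i f i) y = \sum_i dotp (f i) y.
Proof.
rewrite dotpE !summxE !mulr_suml -big_split /=.
by apply: eq_bigr => i _; rewrite dotpE.
Qed.

Lemma dotpC x y : dotp x y = dotp y x.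
Proof. by rewrite !dotpE mulrC [x 0 1 * _]mulrC. Qed.

Lemma dotpZl (a : R) x y : dotp (a *: x) y = a * dotp x y.
Proof. by rewrite !dotpE !mxE mulrDr !mulrA. Qed.

Lemma dotp_ge0 x : 0 <= dotp x x.
Proof. by rewrite dotpE -!expr2 addr_ge0 ?sqr_ge0. Qed.

Lemma enorm_ge0 x : 0 <= enorm x.
Proof. exact: sqrtr_ge0. Qed.

Lemma enorm_sqr x : enorm x ^+ 2 = dotp x x.
Proof. by rewrite sqr_sqrtr // dotp_ge0. Qed.

Lemma enormZ (a : R) x : enorm (a *: x) = `|a| * enorm x.
Proof.
rewrite /enorm dotpZl dotpC dotpZl mulrA -expr2 sqrtrM ?sqr_ge0 //.
by rewrite sqrtr_sqr.
Qed.

Lemma enorm_rot x : enorm (rot x) = enorm x.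
Proof. by congr Num.sqrt; rewrite !dotpE !mxE /=; ring. Qed.

Lemma unit_vectorN n : unit_vector n -> unit_vector (- n).
Proof. by rewrite /unit_vector -scaleN1r enormZ normrN1 mul1r. Qed.

(** The sign condition pins down which of the two unit normals n is: rotating an
    edge d by a quarter turn gives a normal of the same length as d, and d sees
    the inner point (in direction w) on the left or on the right according to
    the sign of S, the orientation of the cell. *)
Lemma unit_normalE n d w (S : R) : unit_vector n -> dotp n d = 0 ->
  dotp n w < 0 -> 0 < cross d w * S ->
  enorm d *: n = - Num.sg S *: rot d.
Proof.
move=> n1 nd nw dwS; pose k := cross n d.
have nn : n 0 0 ^+ 2 + n 0 1 ^+ 2 = 1.
  by have := enorm_sqr n; rewrite n1 dotpE expr1n -!expr2.
(* n and its quarter turn form an orthonormal basis, in which d has the only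
   component k. *)
have d0 : d 0 0 = - (n 0 1 * k).
  have -> : d 0 0 = d 0 0 * (n 0 0 ^+ 2 + n 0 1 ^+ 2) by rewrite nn mulr1.
  rewrite /k /cross; rewrite dotpE in nd.
  rewrite -[LHS]subr0 -(mulr0 (n 0 0)) -nd; ring.
have d1 : d 0 1 = n 0 0 * k.
  have -> : d 0 1 = d 0 1 * (n 0 0 ^+ 2 + n 0 1 ^+ 2) by rewrite nn mulr1.
  rewrite /k /cross; rewrite dotpE in nd.
  rewrite -[LHS]subr0 -(mulr0 (n 0 1)) -nd; ring.
have normd : enorm d = `|k|.
  rewrite -sqrtr_sqr; congr Num.sqrt.
  by rewrite dotpE d0 d1 -[RHS]mul1r -nn; ring.
have kS : 0 < k * S.
  have : 0 < - dotp n w * (k * S).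
    by move: dwS; congr (_ < _); rewrite dotpE /cross d0 d1; ring.
  by rewrite pmulr_rgt0 // oppr_gt0.
have sgk : Num.sg k = Num.sg S.
  apply/eqP; rewrite -subr_eq0; move: kS.
  by case: (sgrP k); case: (sgrP S) => *; rewrite ?subrr //; exfalso; nra.
rewrite normd normrEsg -sgk; apply/rowP => i; rewrite !mxE.
have [->|->] : i = 0 \/ i = 1.
- by case: i => [[|[|//]] ?]; [left|right]; apply/val_inj.
- by rewrite /= d1; ring.
- by rewrite /= d0; ring.
Qed.

(** The functional cross d _ has norm |d|, so its values on a disc of radius r
    spread over an interval of length 2 r |d|. *)
Lemma disc_width x d (r B : R) : 0 < r ->
  (forall y z, enorm (y - x) <= r -> enorm (z - x) <= r ->
     cross d (y - z) <= B) ->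
  2 * r * enorm d <= B.
Proof.
move=> r0 strip; have [d0|dn0] := eqVneq (enorm d) 0.
  have := strip x x; rewrite subrr d0 mulr0.
  have -> : enorm (0 : 'rV[R]_2) = 0.
    by rewrite -(scale0r (0 : 'rV[R]_2)) enormZ normr0 mul0r.
  by move/(_ (ltW r0) (ltW r0)); rewrite /cross !mxE !mulr0 subr0.
(* x + v and x - v are the ends of the diameter orthogonal to d. *)
pose v := (r / enorm d) *: rot d.
have normv : enorm v = r.
  rewrite enormZ enorm_rot ger0_norm ?divr_ge0 ?enorm_ge0 ?ltW //.
  by rewrite divfK.
have /strip : enorm (x + v - x) <= r by rewrite addrC addKr normv.
have vN : enorm (x - v - x) <= r.
  by rewrite addrC addKr -scaleN1r enormZ normrN1 mul1r normv.
move=> /(_ _ vN); congr (_ <= _).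
have := enorm_sqr d; rewrite dotpE => dd.
transitivity (2 * (r / enorm d) * (d 0 0 * d 0 0 + d 0 1 * d 0 1)).
  by rewrite /cross !mxE /=; ring.
by rewrite -dd; field.
Qed.

End Plane.

(** * Geometry of triangles and twin triangles *)

Section CellGeometry.
Variables (R : realType) (s : cell_shape R).
Implicit Types (j : 'I_(nedges s)).

(** The fraction of its side of the triangle that the edge j occupies. *)
Definition side_share j : R := if twin s && (2 <= j)%N then 2^-1 else 1.

Definition signed_area2 : R := cross (vtx2 s - vtx1 s) (vtx3 s - vtx1 s).

Lemma areaE : area s = 2^-1 * `|signed_area2|.
Proof. by []. Qed.

Lemma side_share_gt0 j : 0 < side_share j.
Proof. by rewrite /side_share; case: ifP => // _; rewrite invr_gt0. Qed.

Lemma sum_edge_vectors : \sum_(j < nedges s) (edge_tgt j - edge_src j) = 0.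
Proof.
rewrite sumrB; apply/eqP; rewrite subr_eq0; apply/eqP.
rewrite /edge_tgt /edge_src.
have ordS_inj : injective (@ordS (nedges s)) by apply: ordS_inj.
by rewrite [RHS](reindex_inj ordS_inj).
Qed.

End CellGeometry.

Lemma sum_side_share (R : realType) (s : cell_shape R) :
  \sum_(j < nedges s) side_share j = 3.
Proof.
case: s => v1 v2 v3 [|]; rewrite /side_share /nedges /=.
  by rewrite !big_ord_recl big_ord0 /=; field.
by rewrite !big_ord_recl big_ord0 /=; ring.
Qed.

(** The midpoints of the two halves of a side average to the midpoint of the
    side, so a twin triangle behaves like a triangle with three sides. *)
Lemma side_share_mid (R : realType) (s : cell_shape R) :
  \sum_(j < nedges s) side_share j *: (edge_mid j - centroid s) = 0.
Proof.
case: s => v1 v2 v3 [|]; rewrite /side_share /nedges /=; apply/rowP => i.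
  rewrite !big_ord_recl big_ord0 /edge_mid /edge_src /edge_tgt /corner.
  by rewrite /midpoint /centroid !mxE /=; field.
rewrite !big_ord_recl big_ord0 /edge_mid /edge_src /edge_tgt /corner.
by rewrite /midpoint /centroid !mxE /=; field.
Qed.

(** The common sign of the right-hand sides says that the centroid lies on the
    same side of all edges when these are followed around the cell. *)
Lemma cross_edge_centroid (R : realType) (s : cell_shape R)
  (j : 'I_(nedges s)) :
  cross (edge_tgt j - edge_src j) (centroid s - edge_mid j)
  = side_share j / 3 * signed_area2 s.
Proof.
case: s j => v1 v2 v3 [|] []; rewrite /nedges /=.
- case=> [|[|[|[|k]]]] ltj; last (by have : (k.+4 < 4)%N := ltj);
  rewrite /cross /signed_area2 /side_share /edge_mid /edge_src /edge_tgt;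
  by rewrite /corner /cross /midpoint /centroid /= !mxE /=; field.
- case=> [|[|[|k]]] ltj; last (by have : (k.+3 < 3)%N := ltj);
  rewrite /cross /signed_area2 /side_share /edge_mid /edge_src /edge_tgt;
  by rewrite /corner /cross /midpoint /centroid /= !mxE /=; field.
Qed.

(** The triangle lies in a strip along each of its sides: cross with the side
    vector varies, between two points of the cell, by twice the signed area
    times the change of the barycentric coordinate of the opposite vertex. *)
Lemma cross_edge_le (R : realType) (s : cell_shape R) (j : 'I_(nedges s)) y z :
  cell_set s y -> cell_set s z ->
  cross (edge_tgt j - edge_src j) (y - z) <= side_share j * (2 * area s).
Proof.
move=> [a [b [c [a0 b0 c0 abc yE]]]] [a' [b' [c' [a0' b0' c0' abc' zE]]]].
have area2 : 2 * area s = `|signed_area2 s|.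
  by rewrite areaE mulrA divff ?mul1r ?pnatr_eq0.
(* t is the difference of the barycentric coordinates of y and z at the vertex
   opposite to the side that carries j. *)
suff [t [t1 ->]] : exists t : R, `|t| <= 1 /\
    cross (edge_tgt j - edge_src j) (y - z)
    = side_share j * (t * signed_area2 s).
  rewrite area2 ler_pM2l ?side_share_gt0 // (le_trans (ler_norm _)) //.
  by rewrite normrM ler_piMl.
have aE : a = 1 - b - c by lra.
have aE' : a' = 1 - b' - c' by lra.
rewrite {}yE {}zE {area2}.
have [t1 t2 t3] : [/\ `|c - c'| <= 1, `|a - a'| <= 1 & `|b - b'| <= 1].
  by rewrite !ler_norml; split; apply/andP; split; lra.
rewrite {}aE {}aE' in t2 *; clear -t1 t2 t3.
case: s j => v1 v2 v3 [|] []; rewrite /nedges /=.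
- case=> [|[|[|[|k]]]] ltj; last (by have : (k.+4 < 4)%N := ltj);
    [exists (c - c')|exists (1 - b - c - (1 - b' - c'))
    |exists (b - b')|exists (b - b')]; split=> //;
  rewrite /cross /signed_area2 /side_share /edge_mid /edge_src /edge_tgt;
  by rewrite /corner /cross /midpoint /= !mxE /=; field.
- case=> [|[|[|k]]] ltj; last (by have : (k.+3 < 3)%N := ltj);
    [exists (c - c')|exists (1 - b - c - (1 - b' - c'))
    |exists (b - b')]; split=> //;
  rewrite /cross /signed_area2 /side_share /edge_mid /edge_src /edge_tgt;
  by rewrite /corner /cross /midpoint /= !mxE /=; field.
Qed.

(** The inscribed disc fits in the strip of [cross_edge_le]. *)
Lemma inradius_edge_length (R : realType) (s : cell_shape R)
  (j : 'I_(nedges s)) x (r : R) : inscribed_circle s x r ->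
  r * edge_length j <= side_share j * area s.
Proof.
case=> r0 disc _ _ _.
rewrite -(@ler_pM2l _ 2) // mulrA [leRHS]mulrCA.
apply: (disc_width (x := x)) => // y z yr zr.
exact: cross_edge_le (disc _ yr) (disc _ zr).
Qed.

Lemma incircle_diameter_ge0 (R : realType) (s : cell_shape R) :
  0 <= incircle_diameter s.
Proof.
rewrite /incircle_diameter; case: xgetP => // _ _ [x [r [[r0 _ _ _ _] ->]]].
by rewrite mulr_ge0 // ltW.
Qed.

(** Without an inscribed circle the diameter takes its default value 0 and the
    bound is trivial. *)
Lemma incircle_diameter_edge_length (R : realType) (s : cell_shape R)
  (j : 'I_(nedges s)) :
  incircle_diameter s * edge_length j <= 2 * (side_share j * area s).
Proof.
rewrite /incircle_diameter; case: xgetP => [_ _ [x [r [circ ->]]]|_].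
  by rewrite -mulrA ler_pM2l // (inradius_edge_length _ circ).
by rewrite mul0r !mulr_ge0 ?(ltW (side_share_gt0 _)) ?invr_ge0.
Qed.

(** Up to one sign for the whole cell, |e_j| n_j is the rotated edge vector, and
    the edge vectors close up. *)
Lemma sum_edge_normals (R : realType) (s : cell_shape R)
  (nu : 'I_(nedges s) -> 'rV[R]_2) : 0 < area s ->
  (forall j, outward_normal j (nu j)) ->
  \sum_j edge_length j *: nu j = 0.
Proof.
move=> s0 nuP.
have S0 : 0 < signed_area2 s * signed_area2 s.
  move: s0; rewrite areaE pmulr_rgt0 ?invr_gt0 // normr_gt0.
  by rewrite -expr2 lt_def sqrf_eq0 sqr_ge0 => ->.
have nuE j : edge_length j *: nu j
    = - Num.sg (signed_area2 s) *: rot (edge_tgt j - edge_src j).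
  have [n1 nd nw] := nuP j.
  apply: (unit_normalE n1 nd nw).
  by rewrite cross_edge_centroid -mulrA mulr_gt0 // divr_gt0 ?side_share_gt0.
rewrite (eq_bigr _ (fun j _ => nuE j)) -scaler_sumr.
have rot_sum (f : 'I_(nedges s) -> 'rV[R]_2) :
    \sum_j rot (f j) = rot (\sum_j f j).
  apply/rowP => i; rewrite summxE !mxE !summxE.
  case: ifP => i0; last by apply: eq_bigr => j _; rewrite mxE i0.
  by rewrite -sumrN; apply: eq_bigr => j _; rewrite mxE i0.
rewrite rot_sum sum_edge_vectors.
by apply/rowP => i; rewrite !mxE oppr0; case: ifP; rewrite mulr0.
Qed.

(** * Meshes *)

(** The reconstruction is affine with value u c at the centroid, so the moment
    identity of the midpoints recovers the cell average from the traces. *)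
Lemma side_share_trace (R : realType) (T : mesh R) (u : cell T -> R)
  (L : cell T -> 'rV[R]_2) (c : cell T) :
  \sum_(j < nedges (geom c)) side_share j * interior_trace u L (existT _ c j)
  = 3 * u c.
Proof.
rewrite /interior_trace /reconstruction /=.
under eq_bigr do rewrite mulrDr [dotp _ _]dotpC -dotpZl.
rewrite big_split /= -mulr_suml sum_side_share -dotp_suml side_share_mid.
by rewrite -(scale0r 0) dotpZl mul0r addr0.
Qed.

Lemma mesh_size_le (R : realType) (T : mesh R) (c : cell T) :
  mesh_size T <= incircle_diameter (geom c).
Proof.
apply: ge_inf; last by exists c.
by exists 0 => _ [c' _ <-]; exact: incircle_diameter_ge0.
Qed.

Lemma shared_edge_sym (R : realType) (T : mesh R) (e e' : edge T) :
  shared_edge e e' -> shared_edge e' e.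
Proof.
case=> p [pT neq ee']; exists (- p); split.
- by rewrite -sub0r; apply: mesh_periodB => //; exact: mesh_period0.
- case: neq => neq; [left; exact: nesym|right].
  by move=> /eqP; rewrite oppr_eq0 => /eqP.
- by case: ee' => -[srcE tgtE]; [left|right]; rewrite srcE tgtE !addrK.
Qed.

(** * Numerical fluxes *)

(** By consistency the sum is F(v) tested against the closed-up normals. *)
Lemma flux_sum_const (R : realType) (s : cell_shape R)
  (F : R -> 'rV[R]_2) (Fh : R -> R -> 'rV[R]_2 -> R)
  (nu : 'I_(nedges s) -> 'rV[R]_2) (v : R) : flux_consistent F Fh ->
  0 < area s -> (forall j, outward_normal j (nu j)) ->
  \sum_j Fh v v (nu j) * edge_length j = 0.
Proof.
move=> Fh_cons s0 nuP.
transitivity (dotp (\sum_j edge_length j *: nu j) (F v)).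
  rewrite dotp_suml; apply: eq_bigr => j _.
  by have [n1 _ _] := nuP j; rewrite Fh_cons // dotpZl dotpC mulrC.
by rewrite sum_edge_normals // -(scale0r 0) dotpZl mul0r.
Qed.

(** The infimum of the admissible Lipschitz constants is itself admissible, so
    the CFL condition provides a single constant K; it cannot hold if there is
    no admissible constant, the infimum then being infinite. *)
Lemma cfl_lipschitz (R : realType) (Fh : R -> R -> 'rV[R]_2 -> R) (dt h : R) :
  0 < dt -> (dt%:E * flux_sup_deriv Fh <= h%:E)%E ->
  exists K : R, [/\ 0 <= K, dt * K <= h &
    forall um up vp n, unit_vector n ->
      `|Fh um up n - Fh um vp n| <= K * `|up - vp|].
Proof.
move=> dt0; rewrite /flux_sup_deriv; set B := [set K : R | _].
have inf0 : (0 <= ereal_inf [set K%:E | K in B])%E.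
  by apply: le_ereal_inf_tmp => _ [K [K0 _] <-]; rewrite lee_fin.
case infE : (ereal_inf _) inf0 => [K| |] // K0; last first.
  by rewrite gt0_muley ?lte_fin // leye_eq.
rewrite lee_fin in K0; rewrite -EFinM lee_fin => dtK.
exists K; split=> // um up vp n n1.
have [->|neq] := eqVneq up vp; first by rewrite !subrr normr0 mulr0.
have d0 : 0 < `|up - vp| by rewrite normr_gt0 subr_eq0.
rewrite -ler_pdivrMr // -lee_fin -infE.
apply: le_ereal_inf_tmp => _ [K' [_ K'P] <-].
by rewrite lee_fin ler_pdivrMr // K'P.
Qed.

Section MonotoneFlux.
Variables (R : realType) (Fh : R -> R -> 'rV[R]_2 -> R) (K : R).
Hypothesis Fh_monotone : flux_monotone Fh.
Hypothesis Fh_conservative : flux_conservative Fh.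
Hypothesis FhK : forall um up vp n, unit_vector n ->
  `|Fh um up n - Fh um vp n| <= K * `|up - vp|.

(** By conservation, the first argument of the flux through n is the second one
    of the flux through - n. *)
Lemma flux_lipschitz_left um vm up n : unit_vector n ->
  `|Fh um up n - Fh vm up n| <= K * `|um - vm|.
Proof.
move=> n1; rewrite Fh_conservative // (Fh_conservative vm) //.
by rewrite -opprD normrN; apply: FhK; exact: unit_vectorN.
Qed.

(** Monotonicity replaces up by M at no cost, after which only the first
    argument differs; this is why a Lipschitz bound in one argument is enough. *)
Lemma flux_deficit_max (M um up : R) n : unit_vector n -> um <= M -> up <= M ->
  Fh M M n - Fh um up n <= K * (M - um).
Proof.
move=> n1 umM upM; have [_ incr] := Fh_monotone n1.
apply: (@le_trans _ _ (Fh M M n - Fh um M n)); first by rewrite lerB // incr.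
rewrite (le_trans (ler_norm _)) // -[M - um]ger0_norm ?subr_ge0 //.
exact: flux_lipschitz_left.
Qed.

Lemma flux_excess_min (m um up : R) n : unit_vector n -> m <= um -> m <= up ->
  Fh um up n - Fh m m n <= K * (um - m).
Proof.
move=> n1 umm upm; have [_ incr] := Fh_monotone n1.
apply: (@le_trans _ _ (Fh um m n - Fh m m n)); first by rewrite lerB // incr.
rewrite (le_trans (ler_norm _)) // -[um - m]ger0_norm ?subr_ge0 //.
exact: flux_lipschitz_left.
Qed.

End MonotoneFlux.

(** * The maximum principle *)

(** One half of the maximum principle: a_j stands for the distance of the inner
    trace to the extremal value, g_j for the corresponding flux difference, and
    D for the distance of the cell average to the extremal value. *)
Lemma cell_flux_le (R : realType) (s : cell_shape R) (dt K D : R)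
  (a g : 'I_(nedges s) -> R) : 0 < area s -> 0 < dt ->
  dt * K <= 12^-1 * incircle_diameter s ->
  (forall j, 0 <= a j) -> (forall j, g j <= K * a j) ->
  \sum_j side_share j * a j = 3 * D ->
  dt / area s * \sum_j g j * edge_length j <= D.
Proof.
move=> s0 dt0 dtK a0 gK aD.
have D0 : 0 <= D.
  rewrite -(@pmulr_rge0 _ 3) // -aD; apply: sumr_ge0 => j _.
  by rewrite mulr_ge0 // ltW // side_share_gt0.
apply: (@le_trans _ _ (2^-1 * D)); last first.
  by rewrite ler_piMl // invf_le1 // ler1n.
(* Summand by summand, dt K |e_j| <= w_j |T_0| / 6. *)
have -> : 2^-1 * D = 6^-1 * \sum_j side_share j * a j by rewrite aD; field.
rewrite !mulr_sumr; apply: ler_sum => j _.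
rewrite mulrAC ler_pdivrMr //.
have len0 : 0 <= edge_length j by exact: enorm_ge0.
apply: (@le_trans _ _ (dt * K * edge_length j * a j)).
  by rewrite -!mulrA ler_pM2l // [_ * a j]mulrC mulrA ler_wpM2r.
apply: (@le_trans _ _
    (12^-1 * (incircle_diameter s * edge_length j) * a j)).
  by rewrite ler_wpM2r // [leRHS]mulrA ler_wpM2r.
apply: (@le_trans _ _ (12^-1 * (2 * (side_share j * area s)) * a j)).
  by rewrite ler_wpM2r // ler_wpM2l // incircle_diameter_edge_length.
by rewrite le_eqVlt; apply/orP; left; apply/eqP; field.
Qed.

Theorem theorem4p1 (R : realType) (T : mesh R)
  (F : R -> 'rV[R]_2) (Fh : R -> R -> 'rV[R]_2 -> R)
  (Fh_consistent : flux_consistent F Fh)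
  (Fh_conservative : flux_conservative Fh)
  (Fh_lipschitz : flux_lipschitz Fh)
  (Fh_monotone : flux_monotone Fh)
  (dt : R) (dt_gt0 : 0 < dt)
  (u : cell T -> R) (L : cell T -> 'rV[R]_2)
  (trace_bounds : forall e e' : edge T, shared_edge e e' ->
    Num.min (u (tag e)) (u (tag e')) <= interior_trace u L e
      <= Num.max (u (tag e)) (u (tag e')))
  (cfl : (dt%:E * flux_sup_deriv Fh <= (12^-1 * mesh_size T)%:E)%E)
  (c0 : cell T)
  (nu : 'I_(nedges (geom c0)) -> 'rV[R]_2)
  (nu_outward : forall j, outward_normal j (nu j))
  (nbr : 'I_(nedges (geom c0)) -> edge T)
  (nbr_shared : forall j, shared_edge (existT _ c0 j) (nbr j)) :
  \big[Num.min/u c0]_(j < nedges (geom c0)) u (tag (nbr j))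
    <= fv_update Fh dt u L nu nbr
    <= \big[Num.max/u c0]_(j < nedges (geom c0)) u (tag (nbr j)).
Proof.
have area0 := mesh_nondegenerate c0.
have [K [K0 dtK FhK]] := cfl_lipschitz dt_gt0 cfl.
have dtKc : dt * K <= 12^-1 * incircle_diameter (geom c0).
  by rewrite (le_trans dtK) // ler_wpM2l // mesh_size_le.
have n1 j : unit_vector (nu j) by have [] := nu_outward j.
pose um j := interior_trace u L (existT _ c0 j).
pose up j := interior_trace u L (nbr j).
have um_bounds j : Num.min (u c0) (u (tag (nbr j))) <= um j
    <= Num.max (u c0) (u (tag (nbr j))).
  exact: trace_bounds (nbr_shared j).
have up_bounds j : Num.min (u c0) (u (tag (nbr j))) <= up j
    <= Num.max (u c0) (u (tag (nbr j))).
  by rewrite minC maxC; exact: trace_bounds (shared_edge_sym (nbr_shared j)).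
have share_sub (v : R) :
    \sum_(j < nedges (geom c0)) side_share j * (v - um j) = 3 * (v - u c0).
  under eq_bigr do rewrite mulrBr.
  by rewrite sumrB -mulr_suml sum_side_share side_share_trace mulrBr.
(* v will be the minimum or the maximum of the averages, so that all the flux
   differences have a bound of the same sign. *)
have updateE (v : R) : fv_update Fh dt u L nu nbr = u c0 - dt / area (geom c0)
    * \sum_j (Fh (um j) (up j) (nu j) - Fh v v (nu j)) * edge_length j.
  rewrite /fv_update; congr (_ - _ * _).
  rewrite [RHS](eq_bigr _ (fun j _ => mulrBl _ _ _)) sumrB.
  by rewrite (flux_sum_const _ Fh_consistent) // subr0.
apply/andP; split.
  set m := \big[_/_]_(_ < _) _.
  have min_ge j : m <= Num.min (u c0) (u (tag (nbr j))).
    by rewrite le_min bigmin_le_id bigmin_le.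
  have um_ge j : m <= um j.
    by have /andP[+ _] := um_bounds j; exact: le_trans.
  have up_ge j : m <= up j.
    by have /andP[+ _] := up_bounds j; exact: le_trans.
  rewrite (updateE m) lerBrDl -lerBrDr.
  apply: (@cell_flux_le _ _ dt K _ (fun j => um j - m)) => // [j|j|].
  - by rewrite subr_ge0.
  - exact: (flux_excess_min Fh_monotone).
  - under eq_bigr do rewrite -opprB mulrN.
    by rewrite sumrN share_sub -mulrN opprB.
set M := \big[_/_]_(_ < _) _.
have max_le j : Num.max (u c0) (u (tag (nbr j))) <= M.
  by rewrite ge_max bigmax_ge_id le_bigmax.
have um_le j : um j <= M.
  by have /andP[_ /le_trans] := um_bounds j; exact.
have up_le j : up j <= M.
  by have /andP[_ /le_trans] := up_bounds j; exact.
rewrite (updateE M) -lerBrDl -mulrN -sumrN.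
under eq_bigr do rewrite -mulNr opprB.
apply: (@cell_flux_le _ _ dt K _ (fun j => M - um j)) => // [j|j].
- by rewrite subr_ge0.
- exact: (flux_deficit_max Fh_monotone).
Qed.
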